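(* Let $d\ge 2$, let $N\ge 2$ be even, and for each $n\in\mathbb{Z}/N\mathbb{Z}$ let $\hat P_{n,n+1}$ be an orthogonal projector on $\mathbb{C}^d\otimes\mathbb{C}^d$ (the ordered pair of sites $n,n+1$, with $n\equiv n+N$). Let $\hat f^{\pm},\hat g^{\pm},\hat h^{(0)},\dots,\hat h^{(d-1)}$ be Hermitian operators on $\mathbb{C}^d$ such that, for every $n$, $$\hat P_{n,n+1}(\hat f^+\otimes \mathbb{I}+\mathbb{I}\otimes \hat f^-)\hat P_{n,n+1}=\hat f^+\otimes \mathbb{I}+\mathbb{I}\otimes \hat f^-,$$ $$\hat P_{n,n+1}(\hat g^-\otimes \mathbb{I}+\mathbb{I}\otimes \hat g^+)\hat P_{n,n+1}=\hat g^-\otimes \mathbb{I}+\mathbb{I}\otimes \hat g^+,$$ $$\hat P_{n,n+1}\Big(\sum_{j=0}^{d-1}\hat h^{(j)}\otimes|j\rangle\langle j|\Big)\hat P_{n,n+1}=\sum_{j=0}^{d-1}\hat h^{(j)}\otimes|j\rangle\langle j|.$$ Let $\hat U^{\mathrm{DU},1}$, $\hat U^{\mathrm{DU},2}$, the Floquet operator $\hat{\mathbb{U}}$, the swap circuit $\hat{\mathbb{S}}$ and the target set $\mathcal{T}$ be as defined in the context. Then the gates $\hat U^{\mathrm{DU},1}$ and $\hat U^{\mathrm{DU},2}$ are dual-unitary, and for every $|\psi\rangle\in\mathcal{T}$, $$\hat{\mathbb{U}}|\psi\rangle=\hat{\mathbb{S}}|\psi\rangle .$$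
   Context: Fix the computational basis $\{|i\rangle\}_{i=0}^{d-1}$ of $\mathbb{C}^d$. The dual $\tilde U$ of an operator $\hat U$ on $\mathbb{C}^d\otimes\mathbb{C}^d$ is defined by $(\langle k|\otimes\langle l|)\tilde U(|i\rangle\otimes|j\rangle)=(\langle j|\otimes\langle l|)\hat U(|i\rangle\otimes|k\rangle)$ for all $i,j,k,l$. $\hat U$ is dual-unitary if both $\hat U$ and $\tilde U$ are unitary. The SWAP operator is $\hat S\,|i\rangle\otimes|j\rangle=|j\rangle\otimes|i\rangle$. Given the Hermitian operators in the claim, set $\hat u^+\otimes\hat u^-=\exp\{i(\hat f^+\otimes \mathbb{I}+\mathbb{I}\otimes\hat f^-)\}$, $\hat v^-\otimes\hat v^+=\exp\{i(\hat g^-\otimes \mathbb{I}+\mathbb{I}\otimes\hat g^+)\}$, $\hat V=\exp\{i\sum_{j=0}^{d-1}\hat h^{(j)}\otimes|j\rangle\langle j|\}$, and $$\hat U^{\mathrm{DU},1}=(\hat u^+\otimes\hat u^-)\,\hat S\,\hat V\,(\hat v^-\otimes\hat v^+),\qquad \hat U^{\mathrm{DU},2}=\hat S\,\hat U^{\mathrm{DU},1}\,\hat S .$$ The system consists of $N$ qudits with Hilbert space $(\mathbb{C}^d)^{\otimes N}$, sites $n=0,\dots,N-1$, periodic boundary conditions. A subscript $n,n+1$ on a two-qudit operator means that it acts on sites $n$ (first factor) and $n+1$ (second factor). Define the even and odd layers $\hat{\mathbb{U}}_e=\bigotimes_{j=0}^{N/2-1}\hat U^{\mathrm{DU},1}_{2j,2j+1}$,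 $\hat{\mathbb{U}}_o=\bigotimes_{j=1}^{N/2}\hat U^{\mathrm{DU},2}_{2j-1,2j}$, $\hat{\mathbb{S}}_e=\bigotimes_{j=0}^{N/2-1}\hat S_{2j,2j+1}$, $\hat{\mathbb{S}}_o=\bigotimes_{j=1}^{N/2}\hat S_{2j-1,2j}$, and put $\hat{\mathbb{U}}=\hat{\mathbb{U}}_o\hat{\mathbb{U}}_e$, $\hat{\mathbb{S}}=\hat{\mathbb{S}}_o\hat{\mathbb{S}}_e$. Let $\hat{\mathbb{P}}_{n,n+1}$ be $\hat P_{n,n+1}$ acting on sites $n,n+1$ and as the identity on all other sites. The common kernel is $\mathcal{K}=\{|\psi\rangle:\hat{\mathbb{P}}_{n,n+1}|\psi\rangle=0\ \forall n\}$. The target set $\mathcal{T}$ is the largest subset of $\mathcal{K}$ that is invariant under $\hat{\mathbb{S}}_e$ and $\hat{\mathbb{S}}_o$, i.e. the set of $|\psi\rangle$ such that $W|\psi\rangle\in\mathcal{K}$ for every finite (possibly empty) product $W$ of the operators $\hat{\mathbb{S}}_e,\hat{\mathbb{S}}_o$. *)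

(* Defs.v *)
From mathcomp Require Import all_boot all_order all_algebra.
From mathcomp Require Import all_classical all_reals all_analysis.
From mathcomp Require Export complex mxtens.

Set Implicit Arguments.
Unset Strict Implicit.
Unset Printing Implicit Defensive.

Import Order.TTheory GRing.Theory Num.Theory numFieldNormedType.Exports.
Local Open Scope ring_scope.
Local Open Scope classical_set_scope.

(* An operator X is the matrix with entries X p q = <p| X |q>, acting on column
   vectors.  The basis vector |i> (x) |j> of C^d (x) C^d has index
   mxtens_index (i, j), and A *t B is the Kronecker product.

   The scalars are an arbitrary K : numClosedFieldType because the normed-space
   structure on matrices is not found directly over R[i]; the intended instance
   is K = R[i] with R : realType. *)

(* sum_k X^k / k!, the limit being taken in the normed space of matrices. *)
Definition mxexp (K : numClosedFieldType) (m : nat) (X : 'M[K]_m) : 'M[K]_m :=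
  limn (series (fun k : nat => (k`!%:R : K)^-1 *: X ^+ k)).

Definition orthoprojector (K : numClosedFieldType) (m : nat) (P : 'M[K]_m) :=
  P *m P = P /\ P \is hermsymmx.

Section TwoQudits.
Variables (K : numClosedFieldType) (d : nat).
Implicit Types (U : 'M[K]_(d * d)) (A B f g : 'M[K]_d) (h : 'I_d -> 'M[K]_d).

(* <k l| dualop U |i j> = <j l| U |i k>, with p = (k, l) and q = (i, j). *)
Definition dualop U : 'M[K]_(d * d) :=
  \matrix_(p, q)
    let: (k, l) := mxtens_unindex p in
    let: (i, j) := mxtens_unindex q in
    U (mxtens_index (j, l)) (mxtens_index (i, k)).

Definition dual_unitary U := U \is unitarymx /\ dualop U \is unitarymx.

Definition swap : 'M[K]_(d * d) :=
  \matrix_(p, q)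
    let: (k, l) := mxtens_unindex p in
    let: (i, j) := mxtens_unindex q in
    ((k == j) && (l == i))%:R.

Definition local_sum A B : 'M[K]_(d * d) := A *t 1%:M + 1%:M *t B.

Definition controlled_sum h : 'M[K]_(d * d) :=
  \sum_(j < d) h j *t delta_mx j j.

Definition gate1 fp fm gm gp h : 'M[K]_(d * d) :=
  mxexp ('i *: local_sum fp fm) *m swap *m mxexp ('i *: controlled_sum h)
    *m mxexp ('i *: local_sum gm gp).

Definition gate2 fp fm gm gp h : 'M[K]_(d * d) :=
  swap *m gate1 fp fm gm gp h *m swap.

End TwoQudits.

Arguments swap {K d}.

(* Basis vectors of (C^d)^{(x) N} are the configurations {ffun 'I_N -> 'I_d},
   numbered by enum_rank / enum_val. *)
Notation hdim d N := #|{ffun 'I_N -> 'I_d}|.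

Section Chain.
Variables (K : numClosedFieldType) (d N : nat).
Implicit Types (U : 'M[K]_(d * d)) (P : 'I_N -> 'M[K]_(d * d)).
Implicit Types (psi : 'cV[K]_(hdim d N)).

(* U acting on site n (first factor) and site m (second factor), n != m:
   <a| U_{n,m} |b> = <a_n a_m| U |b_n b_m> prod_{k != n, m} delta_{a_k b_k}. *)
Definition on_sites (n m : 'I_N) U : 'M[K]_(hdim d N) :=
  \matrix_(p, q)
    let a : {ffun 'I_N -> 'I_d} := enum_val p in
    let b : {ffun 'I_N -> 'I_d} := enum_val q in
    if [forall k, (k != n) && (k != m) ==> (a k == b k)]
    then U (mxtens_index (a n, a m)) (mxtens_index (b n, b m)) else 0.

(* The site after n is ordS n, i.e. n + 1 modulo N.  For N even the pairs of
   sites in one layer are disjoint, so the tensor product of the gates is the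
   product of these commuting operators. *)
Definition even_layer U : 'M[K]_(hdim d N) :=
  \prod_(n < N | ~~ odd n) on_sites n (ordS n) U.

Definition odd_layer U : 'M[K]_(hdim d N) :=
  \prod_(n < N | odd n) on_sites n (ordS n) U.

Definition circuit (Uo Ue : 'M[K]_(d * d)) : 'M[K]_(hdim d N) :=
  odd_layer Uo *m even_layer Ue.

(* P n is the projector attached to the ordered pair of sites (n, n + 1). *)
Definition common_kernel P : set 'cV[K]_(hdim d N) :=
  [set psi | forall n, on_sites n (ordS n) (P n) *m psi = 0].

Definition swap_word (w : seq bool) : 'M[K]_(hdim d N) :=
  \prod_(b <- w) (if b then even_layer swap else odd_layer swap).

Definition target_set P : set 'cV[K]_(hdim d N) :=
  [set psi | forall w : seq bool, common_kernel P (swap_word w *m psi)].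

Definition swap_invariant (X : set 'cV[K]_(hdim d N)) :=
  forall psi, X psi ->
    X (even_layer swap *m psi) /\ X (odd_layer swap *m psi).

Lemma target_set_largest P :
  [/\ target_set P `<=` common_kernel P, swap_invariant (target_set P) &
      forall X, X `<=` common_kernel P -> swap_invariant X ->
        X `<=` target_set P].
Proof.
have swap_wordS b w psi :
    swap_word (rcons w b) *m psi
    = swap_word w *m ((if b then even_layer swap else odd_layer swap) *m psi).
  by rewrite /swap_word -cats1 big_cat big_seq1 mulmxA.
split.
- by move=> psi /(_ [::]); rewrite /swap_word big_nil mul1mx.
- move=> psi Tpsi; split=> w.
    by have := Tpsi (rcons w true); rewrite swap_wordS.
  by have := Tpsi (rcons w false); rewrite swap_wordS.
- move=> X XK Xinv psi Xpsi w; elim/last_ind: w psi Xpsi => [|w b IHw] psi Xpsi.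
    by rewrite /swap_word big_nil mul1mx; exact: XK.
  by rewrite swap_wordS; apply: IHw; case: b; case: (Xinv _ Xpsi).
Qed.

End Chain.

(* Main.v *)
Require Import Defs.
From mathcomp Require Import all_boot all_order all_algebra.
From mathcomp Require Import all_classical all_reals all_analysis.
Set Implicit Arguments.
Unset Strict Implicit.
Unset Printing Implicit Defensive.
Import Order.TTheory GRing.Theory Num.Theory numFieldNormedType.Exports.
Local Open Scope ring_scope.
Local Open Scope sesquilinear_scope.

(** A Hermitian operator is diagonalised by a unitary Q, and the exponential
    series then converges entrywise to the conjugate by Q of the phases
    cos t + i sin t at the eigenvalues t.  Hence the local exponentials
    factor as u (x) u', the controlled one is sum_j exp(i h_j) (x) |j><j|, and
    duality maps (u+ (x) u-) S V (v- (x) v+) to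
    (v+^T (x) u-) S V (v- (x) u+^T), a product of unitaries; conjugation by S
    transposes the dual.

    Since P H P = H, exp(iH) = 1 + Y P for some Y, so each exponential fixes
    the common kernel.  Gates of one layer act on disjoint pairs of sites and
    commute, so a layer of products is the product of the layers; on the
    target set all the exponential layers drop out, and only swaps remain. *)

(** * Entrywise convergence and the exponential series of a phase *)

Lemma cvg_mx_entries (K : numFieldType) (T : Type) (F : set_system T)
    (FF : Filter F) (m n : nat) (f : T -> 'M[K]_(m, n)) (L : 'M[K]_(m, n)) :
  (forall i j, (f x i j @[x --> F] --> L i j)%classic) ->
  (f x @[x --> F] --> L)%classic.
Proof.
move=> fL; apply/cvg_ballP => e e0.
(* There are finitely many entries, so a single neighbourhood serves all of them. *)
have : \forall x \near F, forall i j, ball (L i j) e (f x i j).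
  by apply: filter_forall => i; apply: filter_forall => j;
    exact: (cvg_ball (fL i j)).
by apply: filterS => x fx; split.
Qed.

Lemma mxexp_entries (K : numClosedFieldType) (m : nat) (X L : 'M[K]_m) :
  (forall i j, (series (fun k : nat => (k`!%:R : K)^-1 *: X ^+ k) n i j
    @[n --> \oo] --> L i j)%classic) ->
  mxexp X = L.
Proof.
move=> XL; apply: cvg_lim; first exact: norm_hausdorff.
exact: cvg_mx_entries XL.
Qed.

Lemma cvg_sumr (K : numFieldType) (T I : Type) (F : set_system T)
    (FF : Filter F) (r : seq I) (f : I -> T -> K) (l : I -> K) :
  (forall i, (f i x @[x --> F] --> l i)%classic) ->
  ((\sum_(i <- r) f i x) @[x --> F] --> \sum_(i <- r) l i)%classic.
Proof.
move=> fl; elim: r => [|i r IHr].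
  by rewrite big_nil; under eq_fun do rewrite big_nil; exact: cvg_cst.
by rewrite big_cons; under eq_fun do rewrite big_cons; apply: cvgD.
Qed.

Section Phase.
Variable R : realType.
Implicit Types (x t : R).

Let C : numClosedFieldType := R[i].

Lemma cvg_complex (T : Type) (F : set_system T) (FF : Filter F)
    (u v : T -> R) (a b : R) :
  (u x @[x --> F] --> a)%classic -> (v x @[x --> F] --> b)%classic ->
  (((u x +i* v x)%C : C) @[x --> F] --> ((a +i* b)%C : C))%classic.
Proof.
move=> ua vb; apply/cvgrPdist_lt => -[e e'] /=.
(* In the order on [R[i]], [0 < e] forces a zero imaginary part, so the tolerance is real and can be
   halved between the two coordinates. *)
rewrite ltcE /= => /andP[/eqP -> e0].
have e20 : 0 < e / 2 by rewrite divr_gt0.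
near=> x.
have -> : (a +i* b - (u x +i* v x))%C
    = (a - u x)%:C%C + 'i%C * (b - v x)%:C%C :> R[i].
  by rewrite [LHS]complexE.
apply: le_lt_trans (ler_normD _ _) _.
have normR y : `|y%:C%C : R[i]| = (`|y|)%:C%C.
  by rewrite normc_def /= expr0n addr0 sqrtr_sqr.
rewrite normrM !normR normc_def /= expr0n add0r expr1n sqrtr1 mul1r.
rewrite -rmorphD /= ltcR (splitr e) ltrD //; near: x;
  by [apply: cvgr_dist_lt ua _ e20 | apply: cvgr_dist_lt vb _ e20].
Unshelve. all: by end_near. Qed.

Definition cis t : R[i] := (cos t +i* sin t)%C.

Lemma cisD : {morph cis : s t / s + t >-> s * t}.
Proof.
move=> s t; rewrite /cis cosD sinD; congr (_ +i* _)%C.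
by rewrite addrC mulrC.
Qed.

Lemma cis0 : cis 0 = 1. Proof. by rewrite /cis cos0 sin0. Qed.

Lemma cis_conj t : (cis t)^* = cis (- t).
Proof. by rewrite /cis cosN sinN. Qed.

(** Writing n as twice its half plus its parity gives a sign times 1 or i. The two components copy
    the shape of [cos_coeff] and [sin_coeff]; at n = 0 the truncated predecessor is harmless,
    because the parity factor vanishes. *)
Lemma imaginary_exprE n :
  'i ^+ n = ((~~ odd n)%:R * (-1) ^+ n./2 +i*
             ((odd n)%:R * (-1) ^+ n.-1./2))%C :> R[i].
Proof.
rewrite -complexiE -[in LHS](odd_double_half n) addnC exprD.
rewrite -mul2n exprM sqr_i.
have -> : (-1) ^+ n./2 = ((-1) ^+ n./2 : R)%:C%C.
  by rewrite rmorphXn rmorphN rmorph1.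
case: n => [|n] /=; first by simpc.
by rewrite uphalf_half; case: (odd n) => /=; simpc; rewrite ?addr0.
Qed.

Lemma cvg_cis t :
  (series (fun k : nat => (k`!%:R)^-1 * ('i * t%:C%C) ^+ k : C) n
    @[n --> \oo] --> (cis t : C))%classic.
Proof.
(* Even powers of i feed the cosine series and odd ones the sine series, already at the level of
   partial sums. *)
have -> : series (fun k : nat => (k`!%:R)^-1 * ('i * t%:C%C) ^+ k : C) =
    fun n => (series (cos_coeff t) n +i* series (sin_coeff t) n)%C.
  apply/funext => n; rewrite /series /=; elim: n => [|n IHn].
    by rewrite !big_geq.
  rewrite !big_nat_recr //= IHn.
  suff -> : (n`!%:R)^-1 * ('i * t%:C%C) ^+ n
      = (cos_coeff t n +i* sin_coeff t n)%C by [].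
  have -> : (n`!%:R)^-1 = ((n`!%:R)^-1 : R)%:C%C.
    by rewrite fmorphV rmorph_nat.
  rewrite exprMn -rmorphXn mulrC -mulrA -rmorphM /= /cos_coeff /sin_coeff /=.
  rewrite imaginary_exprE.
  by simpc; rewrite !mulrA.
apply: cvg_complex.
  by rewrite cos.unlock; exact: is_cvg_series_cos_coeff.
by rewrite sin.unlock; exact: is_cvg_series_sin_coeff.
Qed.

End Phase.

(** * Two-qudit gates and duality *)

Section TensorIndex.
Variables (m n : nat).

Lemma mxtens_index_inj : injective (@mxtens_index m n).
Proof. exact: can_inj (@mxtens_indexK m n). Qed.

Lemma sum_mxtens (V : nmodType) (F : 'I_(m * n) -> V) :
  \sum_p F p = \sum_i \sum_j F (mxtens_index (i, j)).
Proof.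
rewrite pair_bigA (reindex (@mxtens_index m n)) /=; last first.
  exists (@mxtens_unindex m n) => ? _;
    by rewrite ?mxtens_indexK ?mxtens_unindexK.
by apply: eq_bigr => -[].
Qed.

Lemma tensmx_matrixP (T : Type) (A B : 'M[T]_(m * n)) :
  (forall i j k l, A (mxtens_index (i, j)) (mxtens_index (k, l)) =
                   B (mxtens_index (i, j)) (mxtens_index (k, l))) ->
  A = B.
Proof.
move=> AB; apply/matrixP => p q.
by case: (mxtens_indexP p) => i j; case: (mxtens_indexP q) => k l.
Qed.

End TensorIndex.

Section Gates.
Variables (K : numClosedFieldType) (d : nat).
Implicit Types (A B : 'M[K]_d) (W : 'I_d -> 'M[K]_d) (U : 'M[K]_(d * d)).

Lemma adjmx1 m : (1%:M : 'M[K]_m)^t* = 1%:M.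
Proof. by rewrite trmx1 map_mx1. Qed.

Lemma adjmx_tens A B : (A *t B)^t* = A^t* *t B^t*.
Proof. by rewrite trmx_tens map_mxT. Qed.

Lemma tensmx11 : (1%:M : 'M[K]_d) *t (1%:M : 'M[K]_d) = 1%:M.
Proof.
apply: tensmx_matrixP => i j k l; rewrite tensmxE !mxE.
by rewrite (inj_eq (@mxtens_index_inj d d)) xpair_eqE -natrM mulnb.
Qed.

Lemma tensmx_unitary A B :
  A \is unitarymx -> B \is unitarymx -> A *t B \is unitarymx.
Proof.
move=> /unitarymxP AA /unitarymxP BB; apply/unitarymxP.
by rewrite adjmx_tens tensmx_mul AA BB tensmx11.
Qed.

Lemma controlled_sumE W i j k l :
  controlled_sum W (mxtens_index (i, j)) (mxtens_index (k, l))
  = (j == l)%:R * W l i k.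
Proof.
rewrite /controlled_sum summxE (bigD1 l) //= big1 ?addr0 => [|j' j'l].
  by rewrite tensmxE mxE eqxx andbT mulrC.
by rewrite tensmxE mxE [l == _]eq_sym (negbTE j'l) andbF mulr0.
Qed.

Lemma controlled_sumM W1 W2 :
  controlled_sum W1 *m controlled_sum W2
  = controlled_sum (fun j => W1 j *m W2 j).
Proof.
apply: tensmx_matrixP => i j k l; rewrite mxE sum_mxtens controlled_sumE.
rewrite mxE mulr_sumr; apply: eq_bigr => a _.
rewrite (bigD1 l) //= big1 => [|b bl]; last first.
  by rewrite !controlled_sumE (negbTE bl) mul0r mulr0.
by rewrite addr0 !controlled_sumE eqxx mul1r mulrA.
Qed.

Lemma controlled_sum1 : controlled_sum (fun=> 1%:M) = 1%:M :> 'M[K]_(d * d).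
Proof.
apply: tensmx_matrixP => i j k l; rewrite controlled_sumE !mxE.
by rewrite (inj_eq (@mxtens_index_inj d d)) xpair_eqE andbC -natrM mulnb.
Qed.

Lemma adjmx_controlled_sum W :
  (controlled_sum W)^t* = controlled_sum (fun j => (W j)^t*).
Proof.
apply: tensmx_matrixP => i j k l; rewrite !mxE !controlled_sumE !mxE.
by rewrite rmorphM rmorph_nat; case: eqVneq => [->|]; rewrite ?eqxx ?mul0r.
Qed.

Lemma controlled_sum_unitary W :
  (forall j, W j \is unitarymx) -> controlled_sum W \is unitarymx.
Proof.
move=> WW; apply/unitarymxP; rewrite adjmx_controlled_sum controlled_sumM.
rewrite -controlled_sum1; congr controlled_sum.
by apply/funext => j; apply/unitarymxP.
Qed.

Lemma swapE i j k l :
  @swap K d (mxtens_index (i, j)) (mxtens_index (k, l))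
  = ((i == l) && (j == k))%:R.
Proof. by rewrite mxE !mxtens_indexK. Qed.

Lemma swap_mulE U i j q :
  (swap *m U) (mxtens_index (i, j)) q = U (mxtens_index (j, i)) q.
Proof.
rewrite mxE sum_mxtens (bigD1 j) //= (bigD1 i) //=.
rewrite swapE !eqxx mul1r !big1 ?addr0 // => [k kj|k ki].
  by apply: big1 => l _; rewrite swapE [j == k]eq_sym (negbTE kj) andbF mul0r.
by rewrite swapE [i == k]eq_sym (negbTE ki) mul0r.
Qed.

Lemma mul_swapE U p i j :
  (U *m swap) p (mxtens_index (i, j)) = U p (mxtens_index (j, i)).
Proof.
rewrite mxE sum_mxtens (bigD1 j) //= (bigD1 i) //=.
rewrite swapE !eqxx mulr1 !big1 ?addr0 // => [k kj|k ki].
  by apply: big1 => l _; rewrite swapE (negbTE kj) mulr0.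
by rewrite swapE (negbTE ki) andbF mulr0.
Qed.

Lemma swap_mul_swap : @swap K d *m swap = 1%:M.
Proof.
apply: tensmx_matrixP => i j k l; rewrite swap_mulE swapE mxE.
by rewrite (inj_eq (@mxtens_index_inj d d)) xpair_eqE andbC.
Qed.

Lemma swap_unitary : @swap K d \is unitarymx.
Proof.
apply/unitarymxP.
suff -> : swap^t* = swap :> 'M[K]_(d * d) by exact: swap_mul_swap.
apply: tensmx_matrixP => i j k l; rewrite 2!mxE !swapE rmorph_nat.
by rewrite andbC ![_ == i]eq_sym ![_ == j]eq_sym.
Qed.

Lemma dualopE U k l i j :
  dualop U (mxtens_index (k, l)) (mxtens_index (i, j))
  = U (mxtens_index (j, l)) (mxtens_index (i, k)).
Proof. by rewrite mxE !mxtens_indexK. Qed.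

(* In the dual picture the in-leg of the first qudit and the out-leg of the
   second exchange roles, hence the transposes. *)
Lemma dualop_tens_mulmx A B U :
  dualop (A *t B *m U) = 1%:M *t B *m dualop U *m (1%:M *t A^T).
Proof.
apply: tensmx_matrixP => k l i j; rewrite dualopE !mxE !sum_mxtens.
rewrite [RHS](bigD1 i) //= [X in _ + X]big1 ?addr0 => [|a ai]; last first.
  apply: big1 => b _; rewrite tensmxE [X in _ * (X * _)]mxE (negbTE ai).
  by rewrite mul0r mulr0.
apply: eq_bigr => a _; rewrite tensmxE [X in _ * (X * _)]mxE.
rewrite [X in _ * (_ * X)]mxE eqxx mul1r.
rewrite [X in _ = X * _]mxE sum_mxtens.
rewrite [X in _ = X * _](bigD1 k) //=.
rewrite [X in _ + X]big1 ?addr0 => [|b bk]; last first.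
  by apply: big1 => c _; rewrite tensmxE mxE [k == _]eq_sym (negbTE bk) !mul0r.
rewrite mulr_suml; apply: eq_bigr => b _.
by rewrite !tensmxE dualopE mxE eqxx mul1r -mulrA [RHS]mulrC mulrA.
Qed.

(** [B] sits on the input leg of the second qudit, which duality turns into the output leg of the
    first, so it reappears transposed on the left; the leg carrying [A] stays in place. *)
Lemma dualop_mulmx_tens A B U :
  dualop (U *m (A *t B)) = B^T *t 1%:M *m dualop U *m (A *t 1%:M).
Proof.
apply: tensmx_matrixP => k l i j; rewrite dualopE !mxE !sum_mxtens.
apply: eq_bigr => a _.
rewrite [RHS](bigD1 j) //= [X in _ + X]big1 ?addr0 => [|b bj]; last first.
  by rewrite tensmxE [X in _ * (_ * X)]mxE (negbTE bj) !mulr0.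
rewrite tensmxE [X in _ * (_ * X)]mxE eqxx mulr1 mxE sum_mxtens mulr_suml.
apply: eq_bigr => b _; rewrite [X in _ = X * _](bigD1 l) //=.
rewrite [X in _ + X]big1 ?addr0.
  rewrite !tensmxE dualopE !mxE eqxx mulr1 [B _ _ * _]mulrC -mulrA.
  by rewrite [A _ _ * _]mulrC.
move=> c cl; rewrite tensmxE [X in _ * X * _]mxE [l == _]eq_sym (negbTE cl).
by rewrite mulr0 mul0r.
Qed.

(** The entry of this product contains a Kronecker delta that equates the two legs exchanged by
    duality, so exchanging them changes nothing. This self-dual core is what makes the whole gate
    dual-unitary. *)
Lemma dualop_swap_controlled W :
  dualop (swap *m controlled_sum W) = swap *m controlled_sum W.
Proof.
apply: tensmx_matrixP => k l i j.
rewrite dualopE !swap_mulE !controlled_sumE [j == k]eq_sym.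
by case: eqVneq => [->|]; rewrite ?mul0r.
Qed.

Lemma dualop_swap_conj U : dualop (swap *m U *m swap) = (dualop U)^T.
Proof.
apply: tensmx_matrixP => k l i j.
by rewrite dualopE mul_swapE swap_mulE mxE dualopE.
Qed.

Lemma dual_unitary_swap_conj U :
  dual_unitary U -> dual_unitary (swap *m U *m swap).
Proof.
move=> [Uu Uu']; split; last by rewrite dualop_swap_conj trmx_unitary.
by rewrite !mul_unitarymx // swap_unitary.
Qed.

Lemma dual_unitary_swap_controlled A B A' B' W :
  A \is unitarymx -> B \is unitarymx ->
  A' \is unitarymx -> B' \is unitarymx ->
  (forall j, W j \is unitarymx) ->
  dual_unitary (A *t B *m swap *m controlled_sum W *m (A' *t B')).
Proof.
move=> uA uB uA' uB' /controlled_sum_unitary uW.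
have u1 : 1%:M \is @unitarymx K d d.
  by apply/unitarymxP; rewrite adjmx1 mulmx1.
split; first by rewrite !mul_unitarymx ?tensmx_unitary // swap_unitary.
(* The outer local factors are pulled out of the dual on both sides, which leaves only the self-dual
   core. *)
rewrite dualop_mulmx_tens -(mulmxA _ swap) dualop_tens_mulmx.
rewrite dualop_swap_controlled.
by rewrite !mul_unitarymx ?tensmx_unitary ?trmx_unitary // swap_unitary.
Qed.

End Gates.

(** * Exponentials of Hermitian matrices *)

Section Exponential.
Variable R : realType.
Let C : numClosedFieldType := R[i].

(** Functional calculus in the eigenbasis given by the rows of [Q]. It is spelled out entrywise so
    that convergence of [f] at each eigenvalue passes to every entry through a finite sum. *)
Definition spectral_conj m (Q : 'M[R[i]]_m) (f : 'I_m -> R[i]) : 'M[R[i]]_m :=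
  \matrix_(i, j) \sum_k (Q k i)^* * f k * Q k j.

Lemma spectral_conjE m (Q : 'M[R[i]]_m) f :
  spectral_conj Q f = Q^t* *m diag_mx (\row_j f j) *m Q.
Proof.
apply/matrixP => i j; rewrite !mxE; apply: eq_bigr => k _.
by rewrite mul_mx_diag !mxE.
Qed.

Lemma spectral_conjD m (Q : 'M[R[i]]_m) f g :
  spectral_conj Q (fun k => f k + g k) = spectral_conj Q f + spectral_conj Q g.
Proof.
apply/matrixP => i j; rewrite !mxE -big_split /=.
by apply: eq_bigr => k _; rewrite mulrDr mulrDl.
Qed.

Lemma spectral_conjZ m (Q : 'M[R[i]]_m) a f :
  spectral_conj Q (fun k => a * f k) = a *: spectral_conj Q f.
Proof.
apply/matrixP => i j; rewrite !mxE mulr_sumr.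
by apply: eq_bigr => k _; rewrite [_ * (a * _)]mulrCA !mulrA.
Qed.

Lemma adjmx_spectral_conj m (Q : 'M[R[i]]_m) f :
  (spectral_conj Q f)^t* = spectral_conj Q (fun k => (f k)^*).
Proof.
apply/matrixP => i j; rewrite !mxE rmorph_sum; apply: eq_bigr => k _.
by rewrite !rmorphM /= conjCK mulrC [Q k j * _]mulrC mulrA.
Qed.

Section Unitary.
Variables (m : nat) (Q : 'M[R[i]]_m).
Hypothesis Qu : Q \is unitarymx.

Lemma spectral_conjM f g :
  spectral_conj Q f *m spectral_conj Q g = spectral_conj Q (fun k => f k * g k).
Proof.
rewrite !spectral_conjE; have /unitarymxP := Qu; move: (Q^t*) => Q' QQ'.
rewrite -[in RHS]mulmxA -(mulmxA _ _ Q) -(mulmxA Q') -(mulmxA Q').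
congr (_ *m _); rewrite !mulmxA -(mulmxA _ Q) QQ' mulmx1 mulmx_diag.
by congr (diag_mx _ *m _); apply/rowP => j; rewrite !mxE.
Qed.

Lemma spectral_conj1 : spectral_conj Q (fun=> 1) = 1%:M.
Proof.
rewrite spectral_conjE.
have -> : diag_mx (\row_(_ < m) 1) = 1%:M :> 'M[R[i]]_m.
  by apply/matrixP => i j; rewrite !mxE.
by rewrite mulmx1 -invmx_unitary // mulVmx // unitarymx_unit.
Qed.

Lemma spectral_conjX f k :
  spectral_conj Q f ^+ k = spectral_conj Q (fun j => f j ^+ k).
Proof.
elim: k => [|k IHk]; first exact: esym spectral_conj1.
rewrite exprS IHk [LHS]spectral_conjM; congr spectral_conj.
by apply/funext => j; rewrite exprS.
Qed.

Lemma mxexp_spectral_conj (t : 'I_m -> R) :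
  mxexp ('i *: spectral_conj Q (fun j => (t j)%:C%C))
  = spectral_conj Q (fun j => cis (t j)).
Proof.
apply: (@mxexp_entries C) => i j.
pose s k n :=
  series (fun p : nat => (p`!%:R)^-1 * ('i * (t k)%:C%C) ^+ p : C) n.
rewrite mxE.
(* Powers and linear combinations pass through the functional calculus, so a partial sum of the
   matrix series is the calculus applied to scalar partial sums. *)
have seriesE n : series (fun p : nat => (p`!%:R : C)^-1 *:
      ('i *: spectral_conj Q (fun j => (t j)%:C%C)) ^+ p) n =
    spectral_conj Q (s^~ n).
  rewrite /s /series /=; elim: n => [|n IHn].
    rewrite big_geq //; apply/matrixP => a b; rewrite !mxE big1 // => k _.
    by rewrite big_geq // mulr0 mul0r.
  rewrite big_nat_recr //= IHn.
  under [in RHS]eq_fun do rewrite big_nat_recr //=.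
  rewrite spectral_conjD; congr (_ + _).
  by rewrite -spectral_conjZ spectral_conjX -spectral_conjZ.
under eq_fun do rewrite seriesE mxE.
apply: cvg_sumr => k; apply: (@cvgMr_tmp C); apply: (@cvgMl_tmp C).
exact: cvg_cis.
Qed.

Lemma spectral_conj_cis_unitary (t : 'I_m -> R) :
  spectral_conj Q (fun j => cis (t j)) \is unitarymx.
Proof.
apply/unitarymxP; rewrite adjmx_spectral_conj spectral_conjM -spectral_conj1.
by congr spectral_conj; apply/funext => j; rewrite cis_conj -cisD subrr cis0.
Qed.

End Unitary.

Lemma hermitian_spectral m (H : 'M[R[i]]_m) : H \is hermsymmx ->
  exists2 Q, Q \is unitarymx &
    exists t : 'I_m -> R, H = spectral_conj Q (fun j => (t j)%:C%C).
Proof.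
move=> Hh; exists (spectralmx H); first exact: spectral_unitarymx.
(* The eigenvalues of a Hermitian matrix are real, so taking real parts loses nothing. *)
exists (fun j => complex.Re (spectral_diag H 0 j)).
have /orthomx_spectralP := hermitian_normalmx Hh.
rewrite invmx_unitary ?spectral_unitarymx // => HE.
rewrite spectral_conjE.
have -> : \row_j (complex.Re (spectral_diag H 0 j))%:C%C = spectral_diag H.
  apply/rowP => j; rewrite mxE RRe_real //.
  exact: (mxOverP (hermitian_spectral_diag_real Hh)).
exact: HE.
Qed.

Lemma mxexp_unitary m (H : 'M[R[i]]_m) : H \is hermsymmx ->
  mxexp ('i *: H) \is unitarymx.
Proof.
move=> /hermitian_spectral[Q Qu [t ->]].
rewrite (mxexp_spectral_conj Qu).
exact: spectral_conj_cis_unitary.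
Qed.

(* (exp(ix) - 1) / x is evaluated on the spectrum; at x = 0 the numerator
   vanishes too, so the junk value of the quotient is harmless. *)
Lemma mxexp_sub1 m (H : 'M[R[i]]_m) : H \is hermsymmx ->
  exists Y, mxexp ('i *: H) = 1%:M + Y *m H.
Proof.
move=> /hermitian_spectral[Q Qu [t ->]]; rewrite (mxexp_spectral_conj Qu).
exists (spectral_conj Q (fun j => (cis (t j) - 1) / (t j)%:C%C)).
rewrite (spectral_conjM Qu) -(spectral_conj1 Qu) -spectral_conjD.
congr spectral_conj; apply/funext => j.
have [->|tj0] := eqVneq (t j) 0; first by rewrite cis0 subrr !mul0r addr0.
by rewrite divfK ?fmorph_eq0 // addrC subrK.
Qed.

(** The tensor product of the two diagonalising unitaries diagonalises the local sum with
    eigenvalues s_i + t_j, and [cis] turns these sums into products. *)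
Lemma mxexp_local_sum d (f g : 'M[R[i]]_d) :
  f \is hermsymmx -> g \is hermsymmx ->
  mxexp ('i *: local_sum f g) = mxexp ('i *: f) *t mxexp ('i *: g).
Proof.
move=> /hermitian_spectral[P Pu [s ->]] /hermitian_spectral[Q Qu [t ->]].
have tensE a b : spectral_conj P a *t spectral_conj Q b
    = spectral_conj (P *t Q)
        (fun p => let: (i, j) := mxtens_unindex p in a i * b j).
  rewrite !spectral_conjE -2!tensmx_mul adjmx_tens.
  have -> // : diag_mx (\row_i a i) *t diag_mx (\row_j b j) = diag_mx (\row_p
      let: (i, j) := mxtens_unindex p in a i * b j).
  apply: tensmx_matrixP => i j k l; rewrite tensmxE !mxE !mxtens_indexK.
  rewrite (inj_eq (@mxtens_index_inj d d)) xpair_eqE.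
  by case: eqP => _; case: eqP => _; rewrite ?mulr0n ?mulr1n ?mulr0 ?mul0r.
rewrite (mxexp_spectral_conj Pu) (mxexp_spectral_conj Qu) tensE.
have -> : local_sum (spectral_conj P (fun j => (s j)%:C%C))
                    (spectral_conj Q (fun j => (t j)%:C%C))
    = spectral_conj (P *t Q) (fun p =>
        (let: (i, j) := mxtens_unindex p in s i + t j)%:C%C).
  (* Each identity factor is read as the calculus of the constant 1, so that both summands fall
     under [tensE]. *)
  rewrite /local_sum -{1}(spectral_conj1 Qu) -(spectral_conj1 Pu) !tensE.
  rewrite -spectral_conjD; congr spectral_conj; apply/funext => p.
  by case: (mxtens_unindex p) => i j; rewrite mulr1 mul1r rmorphD.
rewrite (mxexp_spectral_conj (tensmx_unitary Pu Qu)); congr spectral_conj.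
by apply/funext => p; exact: cisD.
Qed.

(** The operator is block diagonal: diagonalising each block by [Q j] amounts to one diagonalisation
    by the unitary [controlled_sum Q], with eigenvalue [t j i] at index (i, j). *)
Lemma mxexp_controlled_sum d (h : 'I_d -> 'M[R[i]]_d) :
  (forall j, h j \is hermsymmx) ->
  mxexp ('i *: controlled_sum h)
  = controlled_sum (fun j => mxexp ('i *: h j)).
Proof.
move=> /(_ _)/hermitian_spectral hh.
have /choice[Qt hQt] : forall j, exists Qt : 'M[R[i]]_d * ('I_d -> R),
    Qt.1 \is unitarymx /\ h j = spectral_conj Qt.1 (fun k => (Qt.2 k)%:C%C).
  by move=> j; have [Q Qu [t hE]] := hh j; exists (Q, t).
pose Q j := (Qt j).1; pose t j := (Qt j).2.
have Qu j : Q j \is unitarymx by have [] := hQt j.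
have controlledE f : controlled_sum (fun j => spectral_conj (Q j) (f j))
    = spectral_conj (controlled_sum Q)
        (fun p => let: (i, j) := mxtens_unindex p in f j i).
  under [in LHS]eq_fun do rewrite spectral_conjE.
  rewrite spectral_conjE -!controlled_sumM -adjmx_controlled_sum.
  have -> // : controlled_sum (fun j => diag_mx (\row_i f j i))
    = diag_mx (\row_p
      let: (i, j) := mxtens_unindex p in f j i).
  apply: tensmx_matrixP => i j k l; rewrite controlled_sumE !mxE mxtens_indexK.
  rewrite (inj_eq (@mxtens_index_inj d d)) xpair_eqE andbC.
  by case: eqVneq => [->|_]; rewrite ?mul1r ?mul0r.
have -> : h = fun j => spectral_conj (Q j) (fun k => (t j k)%:C%C).
  by apply/funext => j; have [] := hQt j.
have -> : (fun j => mxexp ('i *: spectral_conj (Q j) (fun k => (t j k)%:C%C)))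
    = fun j => spectral_conj (Q j) (fun k => cis (t j k)).
  by apply/funext => j; rewrite (mxexp_spectral_conj (Qu j)).
rewrite !controlledE.
have -> : (fun p : 'I_(d * d) =>
      let: (i, j) := mxtens_unindex p in (t j i)%:C%C)
    = fun p => (let: (i, j) := mxtens_unindex p in t j i)%:C%C.
  by apply/funext => p; case: (mxtens_unindex p).
rewrite (mxexp_spectral_conj (controlled_sum_unitary Qu)); congr spectral_conj.
Qed.

End Exponential.

(** * Gates acting on the chain *)

(** The induction only moves [G i] past factors [F j] with j later in [r], hence distinct from i by
    uniqueness. Two operators on the same pair of sites may fail to commute, so commutation is asked
    only at distinct indices. *)
Lemma prodrM_comm_neq (R : pzSemiRingType) (I : eqType) (r : seq I)
    (P : pred I) (F G : I -> R) :
  uniq r ->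
  (forall i j, P i -> P j -> i != j -> GRing.comm (F i) (G j)) ->
  \prod_(i <- r | P i) (F i * G i)
  = \prod_(i <- r | P i) F i * \prod_(i <- r | P i) G i.
Proof.
move=> + FG; elim: r => [|i r IHr] /=; first by rewrite !big_nil mulr1.
move=> /andP[ir r_uniq]; rewrite !big_cons; case: ifP => Pi; last exact: IHr.
rewrite IHr // !mulrA; congr (_ * _); rewrite -!mulrA; congr (_ * _).
rewrite big_seq_cond; apply: commr_prod => j /andP[jr Pj].
by apply/commr_sym/FG => //; apply: contraNneq ir => <-.
Qed.

Section Sites.
Variables (K : numClosedFieldType) (d N : nat).
Local Notation config := {ffun 'I_N -> 'I_d}.
Implicit Types (U A B : 'M[K]_(d * d)) (a b c : config) (n m : 'I_N).

Lemma on_sitesE n m U a b :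
  on_sites n m U (enum_rank a) (enum_rank b)
  = [forall k, (k != n) && (k != m) ==> (a k == b k)]%:R
    * U (mxtens_index (a n, a m)) (mxtens_index (b n, b m)).
Proof. by rewrite mxE !enum_rankK /=; case: ifP; rewrite ?mul1r ?mul0r. Qed.

Lemma on_sites_matrixP (X Y : 'M[K]_(hdim d N)) :
  (forall a b, X (enum_rank a) (enum_rank b) = Y (enum_rank a) (enum_rank b)) ->
  X = Y.
Proof.
by move=> XY; apply/matrixP => p q; rewrite -[p]enum_valK -[q]enum_valK.
Qed.

Lemma sum_config (F : 'I_(hdim d N) -> K) :
  \sum_p F p = \sum_(c : config) F (enum_rank c).
Proof. apply: reindex; exact: onW_bij (@enum_rank_bij config). Qed.

Definition update2 n m (i j : 'I_d) a : config :=
  [ffun k => if k == n then i else if k == m then j else a k].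

Lemma on_sitesD n m A B :
  on_sites n m (A + B) = on_sites n m A + on_sites n m B.
Proof.
by apply: on_sites_matrixP => a b; rewrite [RHS]mxE !on_sitesE mxE mulrDr.
Qed.

Lemma on_sites1 n m : on_sites n m (1%:M : 'M[K]_(d * d)) = 1%:M.
Proof.
apply: on_sites_matrixP => a b; rewrite on_sitesE !mxE -natrM mulnb.
rewrite (inj_eq (@mxtens_index_inj d d)) (inj_eq enum_rank_inj); congr (_%:R).
congr nat_of_bool.
apply/andP/eqP => [[/forallP ab /eqP[abn abm]]|->]; last first.
  by split=> //; apply/forallP => k; rewrite eqxx implybT.
apply/ffunP => k; have /implyP := ab k.
by case: eqVneq => [->|_] //; case: eqVneq => [->|_] // /(_ isT)/eqP.
Qed.

(** An intermediate configuration that contributes agrees with [a] off the two sites, so it is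
    determined by its values there; as the sites differ, these range freely over all pairs, as in
    the two-qudit product. *)
Lemma on_sitesM n m A B : n != m ->
  on_sites n m (A *m B) = on_sites n m A *m on_sites n m B.
Proof.
move=> nm; apply: on_sites_matrixP => a b.
rewrite on_sitesE [RHS]mxE sum_config.
rewrite mxE sum_mxtens pair_bigA /= mulr_sumr.
rewrite [RHS](bigID (fun c : config =>
  [forall k, (k != n) && (k != m) ==> (a k == c k)])) /=.
rewrite [X in _ + X]big1 ?addr0 => [|c /negbTE ac]; last first.
  by rewrite on_sitesE ac !mul0r.
rewrite [RHS](reindex_onto (fun ij => update2 n m ij.1 ij.2 a)
                (fun c : config => (c n, c m))) /=; last first.
  move=> c /forallP ac; apply/ffunP => k; rewrite ffunE.
  have /implyP := ac k.
  by case: eqVneq => [->|_] //; case: eqVneq => [->|_] // /(_ isT)/eqP.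
apply: eq_big => [[i j]|[i j] _] /=.
  rewrite !ffunE !eqxx [m == n]eq_sym (negbTE nm) eqxx andbT; symmetry.
  by apply/forallP => k; rewrite ffunE; case: (k == n); case: (k == m) => //=.
rewrite !on_sitesE !ffunE !eqxx [m == n]eq_sym (negbTE nm).
have -> : [forall k, (k != n) && (k != m) ==> (a k == update2 n m i j a k)].
  by apply/forallP => k; rewrite ffunE; case: (k == n); case: (k == m) => //=.
have -> : [forall k, (k != n) && (k != m) ==> (update2 n m i j a k == b k)]
    = [forall k, (k != n) && (k != m) ==> (a k == b k)].
  by apply: eq_forallb => k; rewrite ffunE; case: (k == n); case: (k == m).
by rewrite mul1r mulrCA.
Qed.

Lemma on_sites_mul_disjoint n m n' m' A B :
  [&& n != n', n != m', m != n' & m != m'] -> forall a b,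
  (on_sites n m A *m on_sites n' m' B) (enum_rank a) (enum_rank b)
  = [forall k, [&& k != n, k != m, k != n' & k != m'] ==> (a k == b k)]%:R
    * (A (mxtens_index (a n, a m)) (mxtens_index (b n, b m))
       * B (mxtens_index (a n', a m')) (mxtens_index (b n', b m'))).
Proof.
move=> /and4P[nn' nm' mn' mm'] a b; rewrite mxE sum_config.
(* The only contributing intermediate configuration: the second gate forces the values of [b] on n
   and m, the first one those of [a] elsewhere. *)
pose c0 := update2 n m (b n) (b m) a.
rewrite (bigD1 c0) //= big1 ?addr0 => [|c]; last first.
  rewrite !on_sitesE.
  case: (boolP [forall k, (k != n) && (k != m) ==> (a k == c k)]);
    last by rewrite !mul0r.
  move=> /forallP ac.
  case: (boolP [forall k, (k != n') && (k != m') ==> (c k == b k)]);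
    last by rewrite mul0r mulr0.
  move=> /forallP cb; case/eqP; apply/ffunP => k; rewrite ffunE.
  case: eqVneq => [->|kn]; first by apply/eqP; have := cb n; rewrite nn' nm'.
  case: eqVneq => [->|km]; first by apply/eqP; have := cb m; rewrite mn' mm'.
  by symmetry; apply/eqP; have := ac k; rewrite kn km.
rewrite !on_sitesE !ffunE !eqxx.
rewrite [n' == n]eq_sym [n' == m]eq_sym [m' == n]eq_sym [m' == m]eq_sym.
rewrite (negbTE nn') (negbTE nm') (negbTE mn') (negbTE mm').
have -> : (if m == n then b n else b m) = b m by case: eqVneq => [->|].
have -> : [forall k, (k != n) && (k != m) ==> (a k == c0 k)].
  by apply/forallP => k; rewrite ffunE; case: (k == n); case: (k == m) => //=.
rewrite mul1r mulrCA; congr (_%:R * _); congr nat_of_bool.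
apply: eq_forallb => k; rewrite ffunE.
case: (eqVneq k n) => [->|_] /=; first by rewrite eqxx implybT.
case: (eqVneq k m) => [->|_] /=; first by rewrite eqxx implybT.
by [].
Qed.

(** The entry formula for disjoint pairs is symmetric in the two gates, up to commuting scalars. *)
Lemma on_sites_comm n m n' m' A B :
  [&& n != n', n != m', m != n' & m != m'] ->
  on_sites n m A *m on_sites n' m' B = on_sites n' m' B *m on_sites n m A.
Proof.
move=> disj; apply: on_sites_matrixP => a b.
have disj' : [&& n' != n, n' != m, m' != n & m' != m].
  rewrite ![_ == n]eq_sym ![_ == m]eq_sym.
  by case/and4P: disj => -> -> -> ->.
rewrite !on_sites_mul_disjoint //; congr (_%:R * _); last by rewrite mulrC.
congr nat_of_bool; apply: eq_forallb => k.
by case: (k == n); case: (k == m); case: (k == n'); case: (k == m').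
Qed.

Definition layer (e : bool) U : 'M[K]_(hdim d N) :=
  \prod_(n < N | odd n == e) on_sites n (ordS n) U.

Lemma even_layerE U : even_layer N U = layer false U.
Proof. by apply: eq_bigl => n; case: (odd n). Qed.

Lemma odd_layerE U : odd_layer N U = layer true U.
Proof. by apply: eq_bigl => n; rewrite eqb_id. Qed.

(** A factorisation, rather than a condition on kernel vectors, because [on_sites] preserves sums,
    products and the identity and so carries it to the whole chain. *)
Definition identity_on_kernel (P : 'I_N -> 'M[K]_(d * d)) U :=
  forall n, exists Y, U = 1%:M + Y *m P n.

Hypotheses (N_gt1 : (1 < N)%N) (N_even : ~~ odd N).

Lemma odd_ordS n : odd (ordS n) = ~~ odd n.
Proof.
have := ltn_ord n; rewrite leq_eqVlt => /predU1P[nN|nN] /=.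
  (* At the wrap-around the successor is site 0; parity still flips because [N] is even. *)
  by rewrite nN modnn /=; move: N_even; rewrite -{1}nN /= negbK => ->.
by rewrite modn_small.
Qed.

Lemma neq_ordS n : n != ordS n.
Proof.
by apply/eqP => /(congr1 (@nat_of_ord N))/(congr1 odd);
  rewrite odd_ordS; case: odd.
Qed.

(** A left and a right site of one layer differ in parity; two right sites differ because [ordS] is
    injective. *)
Lemma same_parity_disjoint n m : odd n = odd m -> n != m ->
  [&& n != m, n != ordS m, ordS n != m & ordS n != ordS m].
Proof.
move=> nm n_neq_m; rewrite n_neq_m (inj_eq (@ordS_inj N)) n_neq_m andbT /=.
by apply/andP; split; apply/eqP => /(congr1 (@nat_of_ord N))/(congr1 odd);
  rewrite odd_ordS nm; case: odd.
Qed.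

Lemma layerM e A B : layer e (A *m B) = layer e A *m layer e B.
Proof.
rewrite /layer -[RHS]prodrM_comm_neq.
- by apply: eq_bigr => n _; rewrite on_sitesM // neq_ordS.
- exact: index_enum_uniq.
- move=> n m /eqP ne /eqP me nm; apply: on_sites_comm.
  by apply: same_parity_disjoint => //; rewrite ne.
Qed.

Lemma layer1 e : layer e 1%:M = 1%:M.
Proof. by rewrite /layer big1 // => n _; rewrite on_sites1. Qed.

Lemma layer_id e (P : 'I_N -> 'M[K]_(d * d)) U (psi : 'cV[K]_(hdim d N)) :
  identity_on_kernel P U -> common_kernel P psi ->
  layer e U *m psi = psi.
Proof.
move=> UP Ppsi; rewrite /layer.
elim/big_rec: _ => [|n X _ IH]; first exact: mul1mx.
(* The big product uses ring multiplication, which is convertible to [*m]. *)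
rewrite -[_ * X]/(_ *m X) -mulmxA IH; have [Y ->] := UP n.
rewrite on_sitesD on_sites1 on_sitesM ?neq_ordS // mulmxDl mul1mx -mulmxA.
by rewrite Ppsi mulmx0 addr0.
Qed.

(** The layers of [D] and [B] fix a target state since it lies in the kernel; the layer of [A] acts
    after a layer of swaps, whose output is again in the target set. *)
Lemma circuit_swap_on_target (P : 'I_N -> 'M[K]_(d * d)) A B D
    (psi : 'cV[K]_(hdim d N)) :
  identity_on_kernel P A -> identity_on_kernel P B -> identity_on_kernel P D ->
  target_set P psi ->
  let U := A *m swap *m B *m D in
  circuit N (swap *m U *m swap) U *m psi = circuit N swap swap *m psi.
Proof.
move=> PA PB PD Tpsi U; have [T_ker T_inv _] := target_set_largest P.
have swap_inv e phi : target_set P phi -> target_set P (layer e swap *m phi).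
  by case: e; rewrite -?even_layerE -?odd_layerE => /T_inv[].
have U_swap e phi : target_set P phi -> layer e U *m phi = layer e swap *m phi.
  move=> Tphi; rewrite !layerM -!mulmxA.
  rewrite (layer_id _ PD (T_ker _ Tphi)) (layer_id _ PB (T_ker _ Tphi)).
  exact: layer_id PA (T_ker _ (swap_inv _ _ Tphi)).
clearbody U; rewrite /circuit !even_layerE !odd_layerE -!mulmxA U_swap //.
have := swap_inv false _ Tpsi; move: (_ *m psi) => phi Tphi.
rewrite (layerM _ swap) (layerM _ U) -!mulmxA U_swap; last exact: swap_inv.
(* On [phi] the odd layer has become three layers of swaps, two of which cancel. *)
by congr (_ *m _); rewrite mulmxA -layerM swap_mul_swap layer1 mul1mx.
Qed.

End Sites.

(** * Hermitian generators supported on the projectors, and the final assembly *)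

Lemma hermsymmxP (K : numClosedFieldType) m (A : 'M[K]_m) :
  reflect (A^t* = A) (A \is hermsymmx).
Proof.
rewrite is_hermitianmxE expr0 scale1r.
by apply: (iffP eqP) => [<-|->].
Qed.

Lemma local_sum_herm (K : numClosedFieldType) d (f g : 'M[K]_d) :
  f \is hermsymmx -> g \is hermsymmx -> local_sum f g \is hermsymmx.
Proof.
move=> /hermsymmxP ff /hermsymmxP gg; apply/hermsymmxP.
by rewrite linearD /= map_mxD !adjmx_tens !adjmx1 ff gg.
Qed.

Lemma controlled_sum_herm (K : numClosedFieldType) d (h : 'I_d -> 'M[K]_d) :
  (forall j, h j \is hermsymmx) -> controlled_sum h \is hermsymmx.
Proof.
move=> hh; apply/hermsymmxP; rewrite adjmx_controlled_sum.
by congr controlled_sum; apply/funext => j; apply/hermsymmxP.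
Qed.

(** With [P] idempotent, P H P = H gives H P = H, so the factor [H] in exp(iH) - 1 absorbs a [P] on
    its right. *)
Lemma mxexp_sub1_projector (R : realType) m (H P : 'M[R[i]]_m) :
  H \is hermsymmx -> P *m P = P -> P *m H *m P = H ->
  exists Y, mxexp ('i *: H) = 1%:M + Y *m P.
Proof.
move=> /mxexp_sub1[Y ->] PP PHP; exists (Y *m H).
by rewrite -PHP -!mulmxA PP.
Qed.

Theorem mainTheorem1 (R : realType) (d N : nat)
    (P : 'I_N -> 'M[R[i]]_(d * d))
    (fp fm gm gp : 'M[R[i]]_d) (h : 'I_d -> 'M[R[i]]_d) :
  (2 <= d)%N -> (2 <= N)%N -> ~~ odd N ->
  (forall n, orthoprojector (P n)) ->
  fp \is hermsymmx -> fm \is hermsymmx ->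
  gm \is hermsymmx -> gp \is hermsymmx ->
  (forall j, h j \is hermsymmx) ->
  (forall n, P n *m local_sum fp fm *m P n = local_sum fp fm) ->
  (forall n, P n *m local_sum gm gp *m P n = local_sum gm gp) ->
  (forall n, P n *m controlled_sum h *m P n = controlled_sum h) ->
  let U1 := gate1 fp fm gm gp h in
  let U2 := gate2 fp fm gm gp h in
  [/\ dual_unitary U1,
      dual_unitary U2 &
      forall psi : 'cV[R[i]]_(hdim d N), target_set P psi ->
        circuit N U2 U1 *m psi = circuit N swap swap *m psi].
Proof.
move=> _ N_gt1 N_even Pproj fp_herm fm_herm gm_herm gp_herm h_herm Pf Pg Ph.
move=> U1 U2.
have U1_dual : dual_unitary U1.
  rewrite /U1 /gate1 (mxexp_local_sum fp_herm fm_herm).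
  rewrite (mxexp_local_sum gm_herm gp_herm) (mxexp_controlled_sum h_herm).
  exact: (dual_unitary_swap_controlled (mxexp_unitary fp_herm)
    (mxexp_unitary fm_herm) (mxexp_unitary gm_herm) (mxexp_unitary gp_herm)
    (fun j => mxexp_unitary (h_herm j))).
split; [exact: U1_dual | exact: dual_unitary_swap_conj |].
(* The three support hypotheses enter through this one fact, applied to each exponential of the
   gate. *)
have exp_id H : H \is hermsymmx -> (forall n, P n *m H *m P n = H) ->
    identity_on_kernel P (mxexp ('i *: H)).
  move=> H_herm PH n.
  exact: (mxexp_sub1_projector H_herm (proj1 (Pproj n)) (PH n)).
move=> psi Tpsi; apply: circuit_swap_on_target Tpsi => //.
- exact: (exp_id _ (local_sum_herm fp_herm fm_herm) Pf).
- exact: (exp_id _ (controlled_sum_herm h_herm) Ph).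
- exact: (exp_id _ (local_sum_herm gm_herm gp_herm) Pg).
Qed.
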